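(* Let $n\ge 1$, let $f=(\alpha_f,\sigma_f)\in G_n$, let $\tau\in\mathcal S_n$ be an involution that reverses $\sigma_f$ (i.e. $\tau\sigma_f\tau^{-1}=\sigma_f^{-1}$), and let $D$ be a set of distinguished representatives of the $\langle\sigma_f,\tau\rangle$-orbits in $\{1,\dots,n\}$ (exactly one distinguished element in each orbit). There exists an involution $T=(\alpha_T,\tau)\in G_n$ that reverses $f$ if and only if for every $u\in D$ $$\sum_{j\in S_u}\alpha_j(f)+\sum_{j\in\tau(S_u)}\alpha_j(f)=0\quad\text{in }\mathbb S_n .\qquad(\dagger\dagger)$$ Under these conditions, for $u\in D$: (A) if $S_u$ is $\tau$-invariant, then $\alpha_u(T)$ is given by (that is, its admissible values are the solutions in $\mathbb S_n$ of) $2\alpha_u(T)=0$ if $\tau(u)=u$, or $2\alpha_u(T)=2\alpha_u(f)$ if $\tau(u)=\sigma_f(u)$, and $\alpha_u(T)$ determines uniquely $\alpha_j(T)$ for all $j\in S_u$; (B) if $S_u$ is not $\tau$-invariant, then $\alpha_u(T)$ can be chosen arbitrarily in $\mathbb S_n$, and this choice determines uniquely $\alpha_j(T)$ for all $j\in S_u\cup\tau(S_u)$.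
   Context: An interval exchange transformation (IET) is a bijection of $[0,1)$ defined by a finite partition of $[0,1)$ into half-open subintervals and a reordering of these intervals by translations. Let $\mathcal S_n$ be the group of permutations of $\{1,\dots,n\}$, $\mathbb S_n=[0,\frac1n]/(0=\frac1n)\cong\mathbb R/\frac1n\mathbb Z$, and $I_i=[\frac{i-1}{n},\frac in)$. $G_n$ is the group of IETs $g$ for which there are $\sigma_g\in\mathcal S_n$ and $\alpha_g=(\alpha_1(g),\dots,\alpha_n(g))\in\mathbb S_n^n$ such that $g$ maps $I_i$ onto $I_{\sigma_g(i)}$ by translating $I_i$ to $I_{\sigma_g(i)}$ and then rotating by $\alpha_i(g)$, i.e. $g(x)=x+\alpha_i(g)+\frac{\sigma_g(i)-i}{n}$ with addition of $\alpha_i(g)$ taken mod $\frac1n$ inside $I_{\sigma_g(i)}$. One writes $g=(\alpha_g,\sigma_g)$; this identifies $G_n$ with $\mathbb S_n^n\rtimes\mathcal S_n$. In a group, $b$ reverses $f$ if $bfb^{-1}=f^{-1}$. An involution is an element whose square is the identity. Given $\sigma=\sigma_f$ and $\tau$ reversing $\sigma$, $S_i$ denotes the $\sigma$-cycle (the $\langle\sigma\rangle$-orbit) of $i$. An element $u\in\{1,\dots,n\}$ is called distinguished if either $\tau(u)\notin S_u$ or $\tau(u)\in\{u,\sigma(u)\}$. (Every $\langle\sigma,\tau\rangle$-orbit contains distinguished elements.) *)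

(* Defs.v *)
From HB Require Import structures.
From mathcomp Require Import all_boot all_order all_algebra all_fingroup.
From mathcomp Require Import ring_quotient archimedean.
From mathcomp Require Import boolp reals.

Set Implicit Arguments.
Unset Strict Implicit.
Unset Printing Implicit Defensive.

Import Order.TTheory GRing.Theory Num.Theory.

Local Open Scope ring_scope.

(* The group of all bijections of an arbitrary type; unlike for {perm T}, the
   product f * g is f after g.                                                *)
Record bij (T : Type) := Bij {
  bij_fun :> T -> T;
  bij_inv : T -> T;
  bij_funK : cancel bij_fun bij_inv;
  bij_invK : cancel bij_inv bij_fun
}.

HB.instance Definition _ (T : Type) := gen_eqMixin (bij T).
HB.instance Definition _ (T : Type) := gen_choiceMixin (bij T).

Section BijGroup.
Variable T : Type.
Implicit Types f g h : bij T.

Lemma bijP f g : f =1 g -> f = g.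
Proof.
case: f g => [f f' fK f'K] [g g' gK g'K] /= /funext efg; subst g.
have ef : f' = g' by apply/funext => x; rewrite -{1}[x]g'K fK.
by subst g'; congr Bij; exact: Prop_irrelevance.
Qed.

Definition bij_one : bij T := @Bij T id id (frefl id) (frefl id).

Definition bij_mul f g : bij T :=
  Bij (can_comp (bij_funK f) (bij_funK g)) (can_comp (bij_invK g) (bij_invK f)).

Definition bij_opp f : bij T := Bij (bij_invK f) (bij_funK f).

Lemma bij_mulA : associative bij_mul. Proof. by move=> f g h; exact: bijP. Qed.
Lemma bij_mul1 : left_id bij_one bij_mul. Proof. by move=> f; exact: bijP. Qed.
Lemma bij_mulr1 : right_id bij_one bij_mul. Proof. by move=> f; exact: bijP. Qed.
Lemma bij_mulV : left_inverse bij_one bij_opp bij_mul.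
Proof. by move=> f; apply: bijP => x; exact: bij_funK. Qed.
Lemma bij_mulrV : right_inverse bij_one bij_opp bij_mul.
Proof. by move=> f; apply: bijP => x; exact: bij_invK. Qed.

HB.instance Definition _ := isGroup.Build (bij T)
  bij_mulA bij_mul1 bij_mulr1 bij_mulV bij_mulrV.
End BijGroup.

(* Both notions are insensitive to replacing the group by its opposite, so the
   left-to-right product of permutations is harmless here.                    *)
Definition involution (G : groupType) (t : G) : Prop := (t ^+ 2 = 1)%g.
Definition reverses (G : groupType) (b f : G) : Prop :=
  (b * f * b^-1 = f^-1)%g.

Definition ico01 (R : realType) : Type := {x : R | 0 <= x < 1}.

(* The pieces [l k, r k) form a finite partition of [0, 1), and g translates
   each of them; bijectivity of g makes this a reordering of the pieces.      *)
Definition is_iet (R : realType) (g : bij (ico01 R)) : Prop :=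
  exists (K : finType) (l r t : K -> R),
    [/\ forall k, 0 <= l k /\ l k < r k /\ r k <= 1,
        forall x : ico01 R, exists! k, l k <= sval x < r k
      & forall (x : ico01 R) k, l k <= sval x < r k ->
          sval (g x) = sval x + t k].

(* For n > 0 this is the subgroup (1/n)Z of R. *)
Definition inv_multiple (R : realType) (n : nat) : {pred R} :=
  [pred x : R | n%:R * x \is a Num.int].
Arguments inv_multiple : clear implicits.

Lemma inv_multiple_zmod_closed (R : realType) (n : nat) :
  zmod_closed (inv_multiple R n).
Proof.
split=> [|x y]; rewrite !inE; first by rewrite mulr0 rpred0.
by rewrite mulrBr; exact: rpredB.
Qed.

HB.instance Definition _ (R : realType) (n : nat) :=
  GRing.isZmodClosed.Build R (inv_multiple R n)
    (inv_multiple_zmod_closed R n).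

(* The circle R / (1/n)Z. *)
Definition circle (R : realType) (n : nat) : zmodType :=
  Quotient.quot (inv_multiple R n).

Definition to_circle (R : realType) (n : nat) (x : R) : circle R n :=
  (\pi_(Quotient.quot (inv_multiple R n)) x)%qT.

Section Gn.
Variables (R : realType) (n : nat).

(* Indices run over 0, ..., n - 1 instead of 1, ..., n. *)
Definition in_I (i : 'I_n) (x : R) : bool := i%:R / n%:R <= x < i.+1%:R / n%:R.

(* g = (a, s) in G_n: for x in I_i, the point g x lies in I_(s i) and differs
   from the translate x + (s i - i)/n of x by a rotation of that circle by
   a i; the two conditions determine g x, since I_(s i) has length 1/n.       *)
Definition Gn_coord (g : bij (ico01 R)) (a : 'I_n -> circle R n) (s : 'S_n) :
    Prop :=
  is_iet g /\
  forall (i : 'I_n) (x : ico01 R), in_I i (sval x) ->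
    in_I (s i) (sval (g x)) /\
    to_circle n (sval (g x)) =
      to_circle n (sval x + ((s i)%:R - i%:R) / n%:R) + a i.

Definition reversing_involution (f : bij (ico01 R)) (tau : 'S_n)
    (T : bij (ico01 R)) (aT : 'I_n -> circle R n) : Prop :=
  [/\ Gn_coord T aT tau, involution T & reverses T f].

Definition distinguished (s tau : 'S_n) (u : 'I_n) : bool :=
  (tau u \notin porbit s u) || (tau u \in [set u; s u]).

Definition orbits2 (s tau : 'S_n) : {set {set 'I_n}} :=
  orbit 'P <<[set s; tau]>>%G @: [set: 'I_n].

Definition distinguished_representatives (s tau : 'S_n) (D : {set 'I_n}) :
    Prop :=
  is_transversal D (orbits2 s tau) [set: 'I_n] /\
  {in D, forall u, distinguished s tau u}.

Definition admissible (f : bij (ico01 R)) (tau : 'S_n) (u : 'I_n)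
    (c : circle R n) : Prop :=
  exists T aT, reversing_involution f tau T aT /\ aT u = c.

Definition determines (f : bij (ico01 R)) (tau : 'S_n) (u : 'I_n)
    (A : {set 'I_n}) : Prop :=
  forall T aT T' aT',
    reversing_involution f tau T aT -> reversing_involution f tau T' aT' ->
    aT u = aT' u -> {in A, aT =1 aT'}.
End Gn.

(* Main.v *)
(* Let a be the rotation vector of f and s its permutation. A map T = (b, tau)
   is an involution iff b i + b (tau i) = 0 for all i, and it reverses f, i.e.
   f T f = T, iff a i + b (s i) + a (tau (s i)) = b i for all i. The second
   equation prescribes the increments of b along a cycle S of s; they are those
   of a function iff they add up to 0 over S, which is condition (††), and then
   b is determined on S by its value at one point. The first equation defines b
   on tau S if tau S <> S; if tau S = S, the function i |-> b i + b (tau i) is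
   constant on S, so that the first equation holds on S iff it holds at the
   distinguished point u of S, which gives the condition on b u. *)
Require Import Defs.
From HB Require Import structures.
From mathcomp Require Import all_boot all_order all_algebra all_fingroup.
From mathcomp Require Import reals.
From mathcomp Require Import ring_quotient archimedean boolp lra.

Set Implicit Arguments.
Unset Strict Implicit.
Unset Printing Implicit Defensive.

Import Order.TTheory GRing.Theory Num.Theory.
Local Open Scope ring_scope.

(** * Functions along a cycle of a permutation *)

(** The primitive at [j] is the partial sum of [d] along the cycle from [u] up to, but excluding,
    [j]. *)
Lemma porbit_primitive {X : finType} {Z : zmodType} (s : {perm X})
    (d : X -> Z) (u : X) :
  \sum_(j in porbit s u) d j = 0 ->
  exists p, p u = 0 /\ {in porbit s u, forall j, p (s j) = p j + d j}.
Proof.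
move=> d0; pose m := #|porbit s u|.
have m_gt0 : (0 < m)%N by apply/card_gt0P; exists u; exact: porbit_id.
have idx k : (k < m)%N -> index (iter k s u) (traject s u m) = k.
  move=> km; rewrite -(nth_traject s km) index_uniq ?size_traject //.
  exact: uniq_traject_porbit.
exists (fun j => \sum_(0 <= l < index j (traject s u m)) d (iter l s u)); split.
  by rewrite (idx 0%N) // big_geq.
move=> j; rewrite porbit_traject => /trajectP[k km ->]; rewrite idx //.
rewrite -big_nat_recr // -iterS.
have [km1|mk] := ltnP k.+1 m; first by rewrite idx.
have {mk} -> : k.+1 = m by apply/eqP; rewrite eqn_leq km mk.
(* At the last point the cycle returns to [u], where the partial sum is empty; this closes up
   because [d] has total 0. *)
rewrite iter_porbit (idx 0%N) // [LHS]big_geq // -[LHS]d0.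
rewrite (eq_bigl _ _ (porbit_traject s u)) -big_uniq ?uniq_traject_porbit //=.
rewrite (big_nth u) size_traject.
by apply: eq_big_nat => i /andP[_ im]; rewrite nth_traject.
Qed.

Lemma porbit_ind {X : finType} (s : {perm X}) (P : X -> Prop) (u : X) :
  P u -> {in porbit s u, forall j, P j -> P (s j)} ->
  {in porbit s u, forall j, P j}.
Proof.
move=> Pu Ps j /porbitP[k ->]; elim: k => [|k IHk]; first by rewrite perm1.
by rewrite expgSr permM; apply: Ps IHk; exact: mem_porbit.
Qed.

Lemma mem_porbit_perm {X : finType} (s : {perm X}) (u j : X) :
  (s j \in porbit s u) = (j \in porbit s u).
Proof. by rewrite porbit_sym -[s]expg1 porbit_perm porbit_sym. Qed.

(** * Reversing cocycles with values in an abelian group *)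

Section Cocycles.
Variables (X : finType) (Z : zmodType) (s tau : {perm X}).
Hypotheses (tauK : involutive tau) (stau : forall i, s (tau (s i)) = tau i).

Definition reversing_cocycle (a b : X -> Z) : Prop :=
  (forall i, b i + b (tau i) = 0) /\
  (forall i, a i + b (s i) + a (tau (s i)) = b i).

(** By [stau], [tau (s j)] is the [s]-predecessor of [tau j], so [tau] maps cycles into cycles; as
    it is an involution, it maps them onto cycles. *)
Lemma imset_porbit u : tau @: porbit s u = porbit s (tau u).
Proof.
have sub v : {in porbit s v, forall j, tau j \in porbit s (tau v)}.
  apply: porbit_ind => [|j _]; first exact: porbit_id.
  by rewrite -(stau j) mem_porbit_perm.
apply/setP => j; apply/imsetP/idP => [[i iu ->]|ju]; first exact: sub.
by exists (tau j); rewrite ?tauK // -[u]tauK; exact: sub.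
Qed.

Lemma mem_porbit_tau u j : (tau j \in porbit s u) = (j \in tau @: porbit s u).
Proof. by rewrite -{2}[j]tauK mem_imset //; exact: perm_inj. Qed.

Lemma imset_porbit_id u : (tau @: porbit s u == porbit s u) =
  (tau u \in porbit s u).
Proof. by rewrite imset_porbit eq_porbit_mem. Qed.

(** Reindexing by [tau \o s] instead of [tau] produces the very term [a (tau (s j))] of the second
    cocycle equation. *)
Lemma sum_porbit_tau a u : \sum_(j in tau @: porbit s u) a j =
  \sum_(j in porbit s u) a (tau (s j)) :> Z.
Proof.
rewrite big_imset /=; last by move=> ? ? _ _; exact: perm_inj.
rewrite (reindex_inj (@perm_inj _ s)) /=.
by apply: eq_bigl => j; exact: mem_porbit_perm.
Qed.

Definition dagger_at (a : X -> Z) u : Prop :=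
  \sum_(j in porbit s u) a j + \sum_(j in tau @: porbit s u) a j = 0.

(** The summands are the differences [b j - b (s j)], which telescope around the cycle. *)
Lemma reversing_cocycle_dagger a b u : reversing_cocycle a b -> dagger_at a u.
Proof.
case=> _ bs; rewrite /dagger_at sum_porbit_tau -big_split /=.
rewrite (eq_bigr (fun j => b j - b (s j))); last first.
  by move=> j _; rewrite -[in RHS](bs j) addrAC addrK.
rewrite sumrB [X in _ - X](_ : _ = \sum_(j in porbit s u) b j) ?subrr //.
rewrite [RHS](reindex_inj (@perm_inj _ s)) /=.
by apply: eq_bigl => j; rewrite mem_porbit_perm.
Qed.

Lemma reversing_cocycle_uniq a b b' u :
  reversing_cocycle a b -> reversing_cocycle a b' -> b u = b' u ->
  {in porbit s u :|: tau @: porbit s u, b =1 b'}.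
Proof.
move=> [bt bs] [bt' bs'] bu.
have eqS : {in porbit s u, b =1 b'}.
  apply: porbit_ind => // j _ bj; apply: (addrI (a j)).
  by apply: (addIr (a (tau (s j)))); rewrite bs bs'.
move=> j; rewrite inE -mem_porbit_tau => /orP[/eqS //|/eqS btj].
by apply: (addIr (b (tau j))); rewrite bt btj bt'.
Qed.

(** Vacuous when the cycle of [u] is not [tau]-invariant: this is the free choice in case (B). *)
Definition compatible (a : X -> Z) u (c : Z) : Prop :=
  tau u \in porbit s u ->
  (tau u = u -> c *+ 2 = 0) /\ (tau u = s u -> c *+ 2 = a u *+ 2).

Lemma reversing_cocycle_compatible a b u :
  reversing_cocycle a b -> compatible a u (b u).
Proof.
move=> [bt bs] _; split => tu; first by rewrite mulr2n -{2}tu bt.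
(* With [s u = tau u] the second equation at [u] reads [a u + b (tau u) + a u = b u], and
   [b (tau u) = - b u]. *)
have := bs u; rewrite -tu tauK => b1; move/eqP: (bt u); rewrite addrC addr_eq0.
by move=> /eqP btu; rewrite mulr2n -{1}b1 btu addrAC subrK.
Qed.

(* A fixed point of both s and tau gives both compatibility conditions; (††)
   makes them agree. *)
Lemma compatible_fixed a u c : dagger_at a u -> tau u = u -> c *+ 2 = 0 ->
  compatible a u c.
Proof.
move=> da tu c0 _; split=> // tsu; rewrite c0.
have su : porbit s u = [set u].
  apply/setP => j; rewrite inE; apply/idP/eqP => [|->]; last exact: porbit_id.
  by move: j; apply: porbit_ind => // j _ ->; rewrite -tsu.
by move: da; rewrite /dagger_at imset_porbit tu su big_set1 -mulr2n => ->.
Qed.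

Lemma compatible_step a u c : dagger_at a u -> tau u = s u ->
  c *+ 2 = a u *+ 2 -> compatible a u c.
Proof.
move=> da tsu ca; have [tu|/eqP tu _] := eqVneq (tau u) u; last by split.
apply: compatible_fixed => //; rewrite ca.
have tuS : tau u \in porbit s u by rewrite tu porbit_id.
(* For the value 0 the fixed-point case yields [a u *+ 2 = 0]. *)
have [_ <- //] := compatible_fixed (c := 0) da tu (mul0rn _ _) tuS.
by rewrite mul0rn.
Qed.

(** Both equations for [c *+ 2] are always solvable, so (††) is the only obstruction to
    existence. *)
Lemma compatible_exists a u : dagger_at a u -> exists c, compatible a u c.
Proof.
move=> da; have [tu|/eqP tu] := eqVneq (tau u) u.
  by exists 0; apply: compatible_fixed; rewrite ?mul0rn.
by exists (a u) => _; split.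
Qed.

(** Solves the equations on one cycle by a primitive shifted by [c]; the first premise is
    distinguishedness of [u] as an implication. *)
Lemma local_cocycle a u c :
    (tau u \in porbit s u -> tau u \in [set u; s u]) ->
    dagger_at a u -> compatible a u c ->
  exists p : X -> Z, [/\ p u = c,
    {in porbit s u, forall j, a j + p (s j) + a (tau (s j)) = p j}
  & tau u \in porbit s u -> {in porbit s u, forall j, p j + p (tau j) = 0}].
Proof.
move=> du; rewrite /dagger_at sum_porbit_tau -big_split /= => da cc.
have [p [pu ps]] : exists p, p u = 0 /\ {in porbit s u,
    forall j, p (s j) = p j - (a j + a (tau (s j)))}.
  by apply: porbit_primitive; rewrite sumrN da oppr0.
exists (fun j => c + p j); rewrite pu addr0.
have step : {in porbit s u,
    forall j, a j + (c + p (s j)) + a (tau (s j)) = c + p j}.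
  by move=> j /ps ->; rewrite addrAC [c + _]addrA addrCA addrN addr0.
split=> // tu; apply: porbit_ind => [|j ju].
  have [c0 ca] := cc tu; move: (du tu); rewrite !inE => /orP[] /eqP tE.
    by rewrite tE pu addr0 -mulr2n c0.
  rewrite pu addr0 tE ps ?porbit_id // pu sub0r -tE tauK.
  by rewrite addrA -!mulr2n ca // addrN.
have tS : tau @: porbit s u = porbit s u by apply/eqP; rewrite imset_porbit_id.
have tsj : tau (s j) \in porbit s u.
  by rewrite mem_porbit_tau tS mem_porbit_perm.
(* As [s (tau (s j)) = tau j], the second equations at [tau (s j)] and at [j] have the same
   [a]-terms; comparing them carries the antisymmetry from [j] to [s j]. *)
have := step _ tsj; rewrite stau tauK => <-; have := step _ ju => <-.
move: (c + p (s j)) (c + p (tau j)) => y z <-.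
by rewrite -!addrA [RHS]addrC -!addrA.
Qed.

Lemma cocycle_glue a (D : {set X}) (r : X -> X) (c : X -> Z) :
    (forall j, [/\ r j \in D, r (s j) = r j, r (tau j) = r j
      & (j \in porbit s (r j)) || (tau j \in porbit s (r j))]) ->
    {in D, forall u, [/\ r u = u,
      tau u \in porbit s u -> tau u \in [set u; s u],
      dagger_at a u & compatible a u (c u)]} ->
  exists b, reversing_cocycle a b /\ {in D, b =1 c}.
Proof.
move=> rP DP.
have /fin_all_exists[p pP] u : exists q : X -> Z, u \in D -> [/\ q u = c u,
    {in porbit s u, forall j, a j + q (s j) + a (tau (s j)) = q j}
  & tau u \in porbit s u -> {in porbit s u, forall j, q j + q (tau j) = 0}].
  have [uD|_] := boolP (u \in D); last by exists c.
  have [_ du da cu] := DP u uD.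
  by have [q ?] := local_cocycle du da cu; exists q.
(* Off the representative's cycle the first cocycle equation forces this value. *)
pose b j := if j \in porbit s (r j) then p (r j) j else - p (r j) (tau j).
have b_tau i : b i + b (tau i) = 0.
  rewrite /b; have [rD _ -> iS] := rP i; have [_ _ pt] := pP _ rD.
  rewrite tauK; case: ifP => iu; case: ifP => tiu.
  (* If both points lie on the representative's cycle, that cycle is [tau]-invariant. *)
  - have ti : tau i \in porbit s (tau (r i)) by rewrite -imset_porbit imset_f.
    rewrite pt //; move: ti tiu; rewrite -!eq_porbit_mem => /eqP <- /eqP <-.
    exact: eqxx.
  - by rewrite addrN.
  - by rewrite addNr.
  - by rewrite iu tiu in iS.
exists b; split; last first.
  move=> u uD; have [ru _ _ _] := DP u uD; rewrite /b ru porbit_id.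
  by have [] := pP u uD.
split=> // i.
have b_s j : j \in porbit s (r j) -> a j + b (s j) + a (tau (s j)) = b j.
  move=> ju; rewrite /b; have [rD -> _ _] := rP j; have [_ ps _] := pP _ rD.
  by rewrite mem_porbit_perm ju ps.
have [_ rs rt /orP[/b_s //|tiu]] := rP i.
(* For [i] in the image cycle, the second equation at [tau (s i)], negated through the first, is the
   one at [i]. *)
have tsi : tau (s i) \in porbit s (r (tau (s i))).
  by have [_ _ -> _] := rP (s i); rewrite rs -mem_porbit_perm stau.
have := b_s _ tsi; rewrite stau tauK => e.
have [b1 b2] := (b_tau i, b_tau (s i)).
move: b1 b2 => /eqP + /eqP; rewrite !addr_eq0 => /eqP -> /eqP ->.
rewrite -e addrAC [_ + b _]addrC -[b _ + _ + _]addrA [a (tau _) + _]addrC.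
by rewrite opprD addrCA addrN addr0.
Qed.

End Cocycles.

(** * Orbits of the group generated by [s] and [tau], and their representatives *)

(** The union on the right contains [u] and is stable under both generators. *)
Lemma orbit2_sub {n : nat} {s tau : 'S_n} :
    involutive tau -> (forall i, s (tau (s i)) = tau i) ->
  forall u, orbit 'P <<[set s; tau]>>%G u \subset
    porbit s u :|: tau @: porbit s u.
Proof.
move=> tauK stau u; set S := porbit s u :|: tau @: porbit s u.
have acts : [acts <<[set s; tau]>>%G, on S | 'P].
  rewrite gen_subG subUset !sub1set; apply/andP; split; apply/astabsP => j;
    rewrite /= apermE !inE ?(imset_porbit tauK stau) ?mem_porbit_perm //.
  rewrite -(imset_porbit tauK stau) mem_imset; last exact: perm_inj.
  by rewrite -(mem_porbit_tau _ tauK) orbC.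
by rewrite acts_sub_orbit // inE porbit_id.
Qed.

Lemma transversal_reps {n : nat} {s tau : 'S_n} {D : {set 'I_n}} :
    involutive tau -> (forall i, s (tau (s i)) = tau i) ->
    is_transversal D (orbits2 s tau) [set: 'I_n] ->
  exists r : 'I_n -> 'I_n,
    (forall j, [/\ r j \in D, r (s j) = r j, r (tau j) = r j
      & (j \in porbit s (r j)) || (tau j \in porbit s (r j))]) /\
    {in D, forall u, r u = u}.
Proof.
move=> tauK stau tD; set G := <<[set s; tau]>>%G.
exists (fun j => transversal_repr j D (orbit 'P G j)).
have orbS g j : g \in [set s; tau] -> orbit 'P G (g j) = orbit 'P G j.
  by move=> gin; apply/orbit_eqP; rewrite -apermE mem_orbit ?mem_gen.
have orbP j : orbit 'P G j \in orbits2 s tau by exact: imset_f.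
(* The default argument of [transversal_repr] varies with the point, but has no effect on blocks of
   the partition. *)
have repr_eq x y B : B \in orbits2 s tau ->
    transversal_repr x D B = transversal_repr y D B.
  by move=> BP; apply: set1_inj; rewrite -!(setI_transversal_pblock tD).
split=> [j|u uD].
  split; first exact: (repr_mem_transversal tD).
  - by rewrite orbS ?inE ?eqxx //; exact: repr_eq.
  - by rewrite orbS ?inE ?eqxx ?orbT //; exact: repr_eq.
  have := repr_mem_pblock tD j (orbP j); rewrite orbit_sym.
  move/(subsetP (orbit2_sub tauK stau _)).
  by rewrite inE (mem_porbit_tau _ tauK).
suff {1}-> : orbit 'P G u = pblock (orbits2 s tau) u by exact: (pblockK tD).
have [/and3P[_ tI _] _] := andP tD.
by rewrite (def_pblock tI (orbP u)) // orbit_refl.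
Qed.

(** * Rotation coordinates of maps of [0, 1) *)

Section Coordinates.
Variables (R : realType) (n : nat).
Hypothesis n_gt0 : (0 < n)%N.

Let nR_gt0 : 0 < n%:R :> R. Proof. by rewrite ltr0n. Qed.
Let nR_neq0 : n%:R != 0 :> R. Proof. by rewrite lt0r_neq0. Qed.

Lemma to_circleD (x y : R) :
  to_circle n (x + y) = to_circle n x + to_circle n y.
Proof. exact: (raddfD \pi_(Quotient.quot (inv_multiple R n))%qT). Qed.

Lemma to_circle_eq (x y : R) :
  (to_circle n x == to_circle n y) = (n%:R * (x - y) \is a Num.int).
Proof. by rewrite -[LHS]Quotient.idealrBE. Qed.

(** The translation from one interval to another is a multiple of 1/n, hence invisible in the
    circle; so [has_coord] can omit it. *)
Lemma to_circle_shift (x : R) (k l : nat) :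
  to_circle n (x + (k%:R - l%:R) / n%:R) = to_circle n x.
Proof.
apply/eqP; rewrite to_circle_eq (addrC x) addrK mulrCA divff // mulr1.
by rewrite rpredB ?natr_int.
Qed.

(** Scaling by [n] gives unit intervals with integer endpoints, suited to floors and linear
    arithmetic. *)
Lemma in_IE (i : 'I_n) (x : R) : in_I i x = (i%:R <= n%:R * x < i%:R + 1).
Proof.
by rewrite /in_I ler_pdivrMr // ltr_pdivlMr // (mulrC x) -natr1.
Qed.

Lemma in_I_eq (i j : 'I_n) (x : R) : in_I i x -> in_I j x -> i = j.
Proof.
rewrite !in_IE => /andP[i1 i2] /andP[j1 j2]; apply: val_inj; apply/eqP.
have := le_lt_trans i1 j2; have := le_lt_trans j1 i2.
by rewrite !natr1 !ltr_nat !ltnS /= eqn_leq => -> ->.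
Qed.

Lemma in_I_ico (i : 'I_n) (x : R) : in_I i x -> 0 <= x < 1.
Proof.
rewrite in_IE => /andP[i1 i2]; have := ltn_ord i; rewrite -(ler_nat R) -natr1.
move=> /(lt_le_trans i2); rewrite gtr_pMr // => ->.
by rewrite andbT -(pmulr_rge0 _ nR_gt0) (le_trans _ i1).
Qed.

Lemma in_I_exists (x : R) : 0 <= x < 1 -> exists i : 'I_n, in_I i x.
Proof.
case/andP=> x0 x1; have nx0 : 0 <= n%:R * x by rewrite mulr_ge0 // ltW.
have /andP[t1 t2] := truncn_itv nx0.
have tn : (Num.truncn (n%:R * x) < n)%N.
  by rewrite -(ltr_nat R) (le_lt_trans t1) // gtr_pMr.
by exists (Ordinal tn); rewrite in_IE natr1 t1.
Qed.

(** Here [n%:R * (x - y)] is an integer strictly between -1 and 1. *)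
Lemma in_I_inj (i : 'I_n) (x y : R) :
  in_I i x -> in_I i y -> to_circle n x = to_circle n y -> x = y.
Proof.
rewrite !in_IE => /andP[x1 x2] /andP[y1 y2] /eqP; rewrite to_circle_eq mulrBr.
move=> /intrP[m mE].
have m0 : m = 0.
  apply/eqP; rewrite -[m == 0]negbK neq_lt; apply/norP; split; rewrite -leNgt.
    by rewrite -ltzD1 -(ltr_int R) rmorphD /= -mE; lra.
  by rewrite -ltzD1 add0r -(ltr_int R) -mE; lra.
by apply: (mulfI nR_neq0); apply/eqP; rewrite -subr_eq0 mE m0.
Qed.

Lemma in_I_lift (i : 'I_n) (c : circle R n) :
  exists2 y : R, in_I i y & to_circle n y = c.
Proof.
elim/quotW: c => x; pose m := Num.floor (n%:R * x).
have /andP[m1 m2] := floor_itv (n%:R * x).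
(* The fractional part of [n%:R * x], moved to the unit interval at [i] and scaled back. *)
exists ((n%:R * x - m%:~R + i%:R) / n%:R).
  rewrite in_IE [_ * (_ / _)]mulrC divfK // -/m in m1 m2 *.
  by move: m2; rewrite rmorphD /=; lra.
apply/eqP; rewrite -/(to_circle n x) to_circle_eq.
rewrite mulrBr [_ * (_ / _)]mulrC divfK // addrAC [_ - _ - _]addrAC addrN add0r.
by rewrite rpredD ?rpredN ?intr_int ?natr_int.
Qed.

(* On functions rather than bijections, so that it can be used to construct
   inverses. *)
Definition has_coord (g : ico01 R -> ico01 R) (a : 'I_n -> circle R n)
    (s : 'S_n) : Prop :=
  forall (i : 'I_n) (x : ico01 R), in_I i (sval x) ->
    in_I (s i) (sval (g x)) /\
    to_circle n (sval (g x)) = to_circle n (sval x) + a i.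

Lemma Gn_coordP (g : bij (ico01 R)) a s :
  Gn_coord g a s <-> is_iet g /\ has_coord g a s.
Proof.
rewrite /Gn_coord /has_coord; split=> -[gi gc]; split=> // i x /gc [].
  by rewrite to_circle_shift.
by rewrite to_circle_shift.
Qed.

(** The second rotation is read at [s i], where [g] has brought the point; the permutation product
    [s * t] likewise applies [s] first. *)
Lemma has_coord_comp g h a b s t : has_coord g a s -> has_coord h b t ->
  has_coord (h \o g) (fun i => a i + b (s i)) (s * t)%g.
Proof.
move=> gc hc i x /gc[gi ge]; have [hi he] := hc _ _ gi.
by rewrite permM /= he ge addrA.
Qed.

Lemma has_coord_id : has_coord id (fun=> 0) 1%g.
Proof. by move=> i x xi; rewrite perm1 addr0. Qed.

Lemma has_coord_eq g h a b s : has_coord g a s -> has_coord h b s ->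
  (forall i, a i = b i) -> g =1 h.
Proof.
move=> gc hc ab x; have [i xi] := in_I_exists (svalP x).
have [[gi ge] [hi he]] := (gc i x xi, hc i x xi).
by apply: val_inj; apply: (in_I_inj (i := s i)); rewrite // ge he ab.
Qed.

Lemma has_coord_uniq g a b s t : has_coord g a s -> has_coord g b t -> a =1 b.
Proof.
move=> ga gb i; have [y yi _] := in_I_lift i 0.
have [_ ea] := ga i (exist _ y (in_I_ico yi)) yi.
have [_ eb] := gb i (exist _ y (in_I_ico yi)) yi.
by move: eb; rewrite ea => /addrI.
Qed.

Lemma has_coord_exists a s : exists g, has_coord g a s.
Proof.
suff /choice[g gP] (x : ico01 R) : exists y : ico01 R, forall i,
    in_I i (sval x) -> in_I (s i) (sval y) /\
      to_circle n (sval y) = to_circle n (sval x) + a i.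
  by exists g => i x; exact: gP.
have [i xi] := in_I_exists (svalP x).
have [y yi ye] := in_I_lift (s i) (to_circle n (sval x) + a i).
exists (exist _ y (in_I_ico yi)) => j xj.
by rewrite -(in_I_eq xi xj).
Qed.

Lemma has_coord_bij a s : exists g : bij (ico01 R), has_coord g a s.
Proof.
have [g gc] := has_coord_exists a s.
(* These are the coordinates of the inverse in the semidirect product. *)
have [h hc] := has_coord_exists (fun i => - a ((s^-1)%g i)) (s^-1)%g.
have gh : cancel g h.
  have := has_coord_comp gc hc; rewrite mulgV => e.
  by apply: (has_coord_eq e has_coord_id) => i; rewrite permK addrN.
have hg : cancel h g.
  have := has_coord_comp hc gc; rewrite mulVg => e.
  by apply: (has_coord_eq e has_coord_id) => i; rewrite addNr.
by exists (Bij gh hg).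
Qed.

(* g rotates I_i by a number rho in [0, 1/n): it translates the part of I_i at
   distance more than rho from the right end by rho, and the remaining part by
   rho - 1/n. Since pieces must be nonempty, I_i is cut at its midpoint
   when rho = 0. *)
Lemma has_coord_iet (g : bij (ico01 R)) a s : has_coord g a s -> is_iet g.
Proof.
move=> gc.
have /fin_all_exists[p pP] (i : 'I_n) : exists p : R * R * R,
    [/\ i%:R / n%:R < p.1.1, p.1.1 < i.+1%:R / n%:R
      & forall x : ico01 R, in_I i (sval x) -> sval (g x) =
          sval x + if sval x < p.1.1 then p.1.2 else p.2].
  have [rho] := in_I_lift (Ordinal n_gt0) (a i).
  rewrite in_IE /= add0r => /andP[rho0 rho1] rhoE.
  (* The rotated point, before reduction, lies in the [k]-th interval, with [k] equal to [i] or,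
     after wrapping, to [i.+1]; [t k] moves it to [I_(s i)]. *)
  pose t (k : nat) := rho + ((s i)%:R - k%:R) / n%:R.
  have gE (k : nat) (x : ico01 R) : in_I i (sval x) ->
      k%:R <= n%:R * sval x + n%:R * rho < k%:R + 1 ->
      sval (g x) = sval x + t k.
    move=> xi zi; have [gi ge] := gc i x xi; apply: (in_I_inj (i := s i)) => //.
      by rewrite in_IE /t addrA !mulrDr [_ * (_ / _)]mulrC divfK //; lra.
    by rewrite /t addrA to_circle_shift ge to_circleD rhoE.
  have [rho_eq0|rho_neq0] := eqVneq rho 0.
    exists ((i%:R + 2^-1) / n%:R, t i, t i); split=> /=.
    - by rewrite ltr_pM2r ?invr_gt0 // ltrDl invr_gt0.
    - by rewrite ltr_pM2r ?invr_gt0 // -[i.+1%:R]natr1 ltrD2l invf_lt1 ?ltr1n.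
    move=> x xi; rewrite if_same; apply: gE => //.
    by rewrite rho_eq0 mulr0 addr0 -in_IE.
  have nrho_gt0 : 0 < n%:R * rho by rewrite lt_neqAle rho0 eq_sym mulf_neq0.
  exists ((i.+1%:R - n%:R * rho) / n%:R, t i, t i.+1); split=> /=.
  - by rewrite ltr_pM2r ?invr_gt0 // -natr1; lra.
  - by rewrite ltr_pM2r ?invr_gt0 // gtrBl.
  move=> x xi; rewrite ltr_pdivlMr // mulrC.
  move: (xi); rewrite in_IE => /andP[x1 x2].
  by case: ltP; rewrite -natr1 => ?; apply: gE => //; rewrite -?natr1; lra.
exists ('I_n * bool)%type,
  (fun k : 'I_n * bool => if k.2 then (p k.1).1.1 else k.1%:R / n%:R),
  (fun k : 'I_n * bool => if k.2 then k.1.+1%:R / n%:R else (p k.1).1.1),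
  (fun k : 'I_n * bool => if k.2 then (p k.1).2 else (p k.1).1.2).
have bounds (i : 'I_n) : 0 <= i%:R / n%:R :> R /\ i.+1%:R / n%:R <= 1 :> R.
  by rewrite divr_ge0 // ler_pdivrMr // mul1r ler_nat.
have cell (x : ico01 R) (k : 'I_n * bool) :
    (if k.2 then (p k.1).1.1 else k.1%:R / n%:R) <= sval x <
      (if k.2 then k.1.+1%:R / n%:R else (p k.1).1.1) =
    in_I k.1 (sval x) && (k.2 == ~~ (sval x < (p k.1).1.1)).
  case: k => i []; have [p1 p2 _] := pP i; rewrite /in_I /= -leNgt.
    rewrite eq_sym eqb_id andbAC; congr (_ && _).
    case: (leP (p i).1.1 (sval x)) => px; rewrite ?andbF // andbT.
    by rewrite (ltW (lt_le_trans p1 px)).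
  rewrite eq_sym eqbF_neg -ltNge.
  case: (ltP (sval x) (p i).1.1) => px; rewrite ?andbF // !andbT.
  by rewrite (lt_trans px p2) andbT.
split=> [[i b]|x|x k].
- have [p1 p2 _] := pP i; have [? ?] := bounds i.
  by case: b => /=; split=> //; lra.
- have [i xi] := in_I_exists (svalP x).
  exists (i, ~~ (sval x < (p i).1.1)); split; first by rewrite cell /= xi eqxx.
  by case=> j b; rewrite cell /= => /andP[/(in_I_eq xi) <- /eqP ->].
- rewrite cell => /andP[xi /eqP kE]; have [_ _ ->] := pP k.1; last exact: xi.
  by rewrite kE; case: ltP.
Qed.

End Coordinates.

(** * Reversing involutions as cocycles, and the theorem *)

(** An inverse-free form, whose coordinates come from composition alone. *)
Lemma reversesP (G : groupType) (b f : G) : reverses b f <-> (f * b * f = b)%g.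
Proof.
rewrite /reverses; split=> [e|e].
  by rewrite -mulgA -[(b * f)%g](mulgKV b) e mulgA mulgV mul1g.
by rewrite -{2}e !invgM !mulgA mulgK mulgV mul1g.
Qed.

(** [T \o T] has the permutation of [id], and [f \o T \o f] that of [T], so equality of these maps
    is equality of rotation vectors. *)
Lemma reversing_involution_cocycle (R : realType) (n : nat) (n_gt0 : (0 < n)%N)
    (f T : bij (ico01 R)) (a b : 'I_n -> circle R n) (s tau : 'S_n) :
    involutive tau -> (forall i, s (tau (s i)) = tau i) -> Gn_coord f a s ->
  reversing_involution f tau T b <->
  Gn_coord T b tau /\ reversing_cocycle s tau a b.
Proof.
move=> tauK stau /(Gn_coordP n_gt0)[_ fc].
have tau2 : (tau * tau = 1)%g by apply/permP => i; rewrite permM perm1 tauK.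
have sts : (s * tau * s = tau)%g by apply/permP => i; rewrite !permM stau.
suff coc : has_coord T b tau ->
    (involution T /\ reverses T f) <-> reversing_cocycle s tau a b.
  split=> [[Tc T2 Tf]|[Tc bc]].
    by split=> //; apply/coc => //; have [_] := (Gn_coordP n_gt0 _ _ _).1 Tc.
  by have [_ /coc/iffRL/(_ bc)[]] := (Gn_coordP n_gt0 _ _ _).1 Tc.
move=> Tc; have TT := has_coord_comp Tc Tc.
have fTf := has_coord_comp (has_coord_comp fc Tc) fc.
rewrite tau2 in TT; rewrite sts in fTf.
rewrite reversesP /involution expg2; split=> [[T2 Tf]|[bt bs]].
  split=> i.
    have T2id : T \o T = id.
      by apply/funext => x; exact: (congr1 (fun g : bij _ => g x) T2).
    rewrite T2id in TT.
    exact: (has_coord_uniq n_gt0 TT (@has_coord_id _ _) i).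
  have fTfT : f \o (T \o f) = T.
    by apply/funext => x; exact: (congr1 (fun g : bij _ => g x) Tf).
  rewrite fTfT in fTf; rewrite -(permM s tau i).
  exact: (has_coord_uniq n_gt0 fTf Tc i).
split; apply: bijP.
  exact: (has_coord_eq n_gt0 TT (@has_coord_id _ _)).
by apply: (has_coord_eq n_gt0 fTf Tc) => i; rewrite permM.
Qed.

Theorem theorem1 (R : realType) (n : nat) (hn : (1 <= n)%N)
    (f : bij (ico01 R)) (af : 'I_n -> circle R n) (sf : 'S_n)
    (hf : Gn_coord f af sf)
    (tau : 'S_n) (tau_inv : involution tau) (tau_rev : reverses tau sf)
    (D : {set 'I_n}) (hD : distinguished_representatives sf tau D) :
  let S u := porbit sf u in
  let dagger := forall u, u \in D ->
    \sum_(j in S u) af j + \sum_(j in tau @: S u) af j = 0 in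
  ((exists T aT, reversing_involution f tau T aT) <-> dagger) /\
  (dagger ->
    (forall u, u \in D ->
      (tau @: S u = S u ->
        (tau u = u ->
          forall c, admissible f tau u c <-> c *+ 2 = 0) /\
        (tau u = sf u ->
          forall c, admissible f tau u c <-> c *+ 2 = af u *+ 2) /\
        determines f tau u (S u)) /\
      (tau @: S u <> S u ->
        (forall c, admissible f tau u c) /\
        determines f tau u (S u :|: tau @: S u))) /\
    (* the values at the different u in D can be prescribed independently *)
    (forall c : 'I_n -> circle R n,
      (forall u, u \in D -> admissible f tau u (c u)) ->
      exists T aT, reversing_involution f tau T aT /\
        forall u, u \in D -> aT u = c u)).
Proof.
move=> S dagger.
have tauK : involutive tau.
  by move=> i; rewrite -permM -expg2 (tau_inv : (tau ^+ 2 = 1)%g) perm1.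
have stau i : sf (tau (sf i)) = tau i.
  by have sts := (reversesP tau sf).1 tau_rev; rewrite -[in RHS]sts !permM.
have riP T b := @reversing_involution_cocycle _ _ hn f T af b _ _ tauK stau hf.
have [trD dD] := hD; have [r [rP rD]] := transversal_reps tauK stau trD.
(* Compatible values can be prescribed on all of [D] at once; every existence claim below reduces to
   this. *)
have ex c : dagger -> {in D, forall u, compatible sf tau af u (c u)} ->
    exists T aT, reversing_involution f tau T aT /\ {in D, aT =1 c}.
  move=> da cc.
  have [|b [bc bD]] := cocycle_glue tauK stau (a := af) (c := c) rP.
    move=> u uD; split; [exact: rD| |exact: da|exact: cc].
    by move=> tu; have := dD u uD; rewrite /distinguished tu.
  have [T Tc] := has_coord_bij hn b tau; exists T, b; split=> //.
  apply/riP; split=> //; apply/Gn_coordP => //; split=> //.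
  exact: has_coord_iet Tc.
have adm u c : dagger -> u \in D -> compatible sf tau af u c ->
    admissible f tau u c.
  (* Take [c] at [u] and any compatible value at the other representatives. *)
  move=> da uD cu; have /fin_all_exists[c0 c0P] v : exists c', v \in D ->
      compatible sf tau af v c' /\ (v = u -> c' = c).
    have [->|vu] := eqVneq v u; first by exists c.
    have [vD|_] := boolP (v \in D); last by exists 0.
    have [c' ?] := compatible_exists tauK stau (da v vD).
    by exists c' => _; split=> // /eqP; rewrite (negPf vu).
  have [||T [b [Tb bD]]] := ex c0 => //.
    by move=> v vD; have [] := c0P v vD.
  by exists T, b; split=> //; rewrite bD //; have [_ ->] := c0P u uD.
have comp u c : admissible f tau u c -> compatible sf tau af u c.
  move=> [T [b [/riP[_ bc] <-]]].
  exact: reversing_cocycle_compatible bc.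
have det u : determines f tau u (S u :|: tau @: S u).
  move=> T b T' b' /riP[_ bc] /riP[_ bc'].
  exact: (reversing_cocycle_uniq tauK bc bc').
split.
  split=> [[T [b /riP[_ bc]]] u _|da].
    exact: reversing_cocycle_dagger bc.
  have /fin_all_exists[c cP] v : exists c', v \in D ->
      compatible sf tau af v c'.
    have [vD|_] := boolP (v \in D); last by exists 0.
    have [c' ?] := compatible_exists tauK stau (da v vD).
    by exists c'.
  by have [T [b [Tb _]]] := ex c da cP; exists T, b.
move=> da; split=> [u uD|c cadm].
  have tS : (tau @: S u == S u) = (tau u \in S u) by exact: imset_porbit_id.
  split=> [/eqP|/eqP]; rewrite tS => tu; last first.
    (* Compatibility is vacuous here since [tau u] is not in [S u]. *)
    split=> [c|//]; apply: adm => //.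
    by move=> tu'; rewrite tu' in tu.
  split; last split.
  - move=> tuu c; split=> [/comp/(_ tu)[/(_ tuu)]//|c0].
    apply: adm => //; apply: (compatible_fixed tauK stau) => //.
    exact: da.
  - move=> tus c; split=> [/comp/(_ tu)[_ /(_ tus)]//|c0].
    apply: adm => //; apply: (compatible_step tauK stau) => //.
    exact: da.
  - move=> T b T' b' Tb Tb' e j jS.
    by apply: (det u T b T' b' Tb Tb' e); rewrite inE jS.
have [T [b [Tb bD]]] := ex c da (fun u uD => comp u _ (cadm u uD)).
by exists T, b.
Qed.
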